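(* Let $\alpha\in(0,1)$ and $C>0$, and let $(D_n)_{n\ge 0}$ be the non-homogeneous Markov chain with parameters $\alpha, C$ defined in the context. Then $$\mathbb{P}\left(\exists\, N\in\mathbb{N}\text{ such that }\forall\, n\ge N,\ D_{n+1}=D_n+1\right)=1.$$
   Context: For parameters $0<\alpha<1$ and $C>0$, $(D_n)_{n\ge 0}$ is the (time-inhomogeneous) discrete-time Markov chain on the non-negative integers with $D_0=0$, $D_1=1$ and the following transitions for $n\ge 1$. If $D_n\neq 0$, then, conditionally on $D_0,\dots,D_n$, $$D_{n+1}=\begin{cases} D_n+1, & \text{with probability } 1-\frac12 e^{-C D_n/n^{\alpha}},\\ D_n-1, & \text{with probability } \frac12 e^{-C D_n/n^{\alpha}},\end{cases}$$ and if $D_n=0$, then $D_{n+1}=1$. *)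

(* Defs.v *)
From HB Require Import structures.
From mathcomp Require Import all_boot all_order all_algebra.
From mathcomp Require Import all_classical all_reals all_analysis.

Set Implicit Arguments.
Unset Strict Implicit.
Unset Printing Implicit Defensive.

Import Order.TTheory GRing.Theory Num.Theory.
Import numFieldNormedType.Exports.

Local Open Scope classical_set_scope.
Local Open Scope ring_scope.

(* Elementary conditional probability of A given B; only meaningful when
   P B is positive (it is 0 otherwise, since 0^-1 = 0). *)
Definition cond_prob (d : measure_display) (T : measurableType d)
    (R : realType) (P : probability T R) (A B : set T) : R :=
  fine (P (A `&` B)) / fine (P B).

Definition history (T : Type) (D : nat -> T -> nat) (x : nat -> nat) (n : nat)
    : set T :=
  [set w | forall i, (i <= n)%N -> D i w = x i].

Definition down_prob (R : realType) (alpha C : R) (n k : nat) : R :=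
  2^-1 * expR (- (C * k%:R / n%:R `^ alpha)).

(* As the state space is countable, conditioning on D_0, ..., D_n amounts to
   conditioning on each event {D_0 = x_0, ..., D_n = x_n} of positive
   probability. *)
Record is_chain (d : measure_display) (T : measurableType d) (R : realType)
    (P : probability T R) (alpha C : R) (D : nat -> {RV P >-> nat}) : Prop :=
  IsChain {
    chain_init0 : P [set w | D 0%N w = 0%N] = 1%E ;
    chain_init1 : P [set w | D 1%N w = 1%N] = 1%E ;
    chain_up : forall (n : nat) (x : nat -> nat), (1 <= n)%N ->
      (0 < P (history D x n))%E -> x n <> 0%N ->
      cond_prob P [set w | D n.+1 w = (x n).+1] (history D x n)
        = 1 - down_prob alpha C n (x n) ;
    chain_down : forall (n : nat) (x : nat -> nat), (1 <= n)%N ->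
      (0 < P (history D x n))%E -> x n <> 0%N ->
      cond_prob P [set w | D n.+1 w = (x n).-1] (history D x n)
        = down_prob alpha C n (x n) ;
    chain_reflect : forall (n : nat) (x : nat -> nat), (1 <= n)%N ->
      (0 < P (history D x n))%E -> x n = 0%N ->
      cond_prob P [set w | D n.+1 w = 1%N] (history D x n) = 1
  }.

(* Main.v *)
Require Import Defs.
From HB Require Import structures.
From mathcomp Require Import all_boot all_order all_algebra.
From mathcomp Require Import all_classical all_reals all_analysis.
From mathcomp Require Import ring lra.

Import Order.TTheory GRing.Theory Num.Theory.
Import numFieldNormedType.Exports.

Local Open Scope classical_set_scope.
Local Open Scope ring_scope.

Set Implicit Arguments.
Unset Strict Implicit.
Unset Printing Implicit Defensive.

(* The number of steps that are not upward has finite expectation from some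
   time on, by the Lyapunov function
     V(n, k) = n ^ (2 b - 1) / (k ^ 2 + s n ^ alpha) ^ b,
   with b (1 - alpha) > 3 / 2 and then s large. Write a = n ^ alpha and
   Y = k ^ 2 + s a. One step of the chain at frozen n multiplies Y ^ (- b) on
   average by at most 1 - g with g about (b / Y) (1 + 2 C k ^ 2 / (a + C k)):
   near 0 the diffusion of k ^ 2 is responsible, for k >> a the upward drift,
   and in between the linear drift C k / a, which dominates the convexity term
   once s is large. Since k <= n, g exceeds by a fixed proportion the growth
   (2 b - 1) / n of the prefactor, so that V decreases by at least V / (8 Y),
   which is larger than the probability exp (- C k / a) / 2 of a down step
   because 2 b - 1 > alpha (2 b + 2). Summing over n bounds the sum of the
   probabilities of non-upward steps, and Borel-Cantelli concludes. *)

(** * Elementary inequalities, and one step of the chain at frozen time *)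

Section Lyapunov.
Variable R : realType.

(** Induction on [b], multiplying by the bound [1 - x + 2 * x ^+ 2] for the inverse of [1 + x]; the
    range of [x] is chosen so that [1 + 2 * x] is nonnegative. *)
Lemma inv_expr_taylor_le (b : nat) : exists2 B : R, 0 < B &
  forall x : R, `|x| <= 2^-1 ->
    ((1 + x) ^+ b)^-1 <= 1 - b%:R * x + B * x ^+ 2.
Proof.
elim: b => [|b [B B0 IH]].
  exists 1 => // x _; rewrite expr0 invr1; have := sqr_ge0 x; lra.
have b0 : 0 <= b%:R :> R by rewrite ler0n.
(* The product has coefficient [2 + b + B] at [x ^+ 2]; doubling [b] and [B] absorbs its terms of
   degree 3 and 4. *)
exists (2 + 2 * b%:R + 2 * B); first lra.
move=> x xh; have := xh; rewrite ler_norml => /andP[x1 x2].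
have x3 : 0 < 1 + x by lra.
have step : (1 + x)^-1 <= 1 - x + 2 * x ^+ 2.
  rewrite -[leLHS]mul1r ler_pdivrMr//.
  have x4 : 0 <= 1 + 2 * x by lra.
  by have := mulr_ge0 (sqr_ge0 x) x4; lra.
rewrite exprS invfM mulrC.
apply: le_trans (ler_pM _ _ (IH x xh) step) _.
- by rewrite invr_ge0 exprn_ge0// ltW.
- by rewrite invr_ge0 ltW.
rewrite -natr1.
have key : 0 <= x ^+ 2 *
   ((2 + 2 * b%:R + 2 * B) - (2 + b%:R + B - 2 * b%:R * x - B * x + 2 * B * x ^+ 2)).
  rewrite mulr_ge0 ?sqr_ge0// subr_ge0.
  have h1 : 0 <= b%:R * (1 + 2 * x) by rewrite mulr_ge0//; lra.
  have h2 : 0 <= B * ((1 + x * 2) * (1 - x)).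
    by rewrite mulr_ge0 ?(ltW B0)// mulr_ge0//; lra.
  lra.
lra.
Qed.

(** Writing [y = p.+1 * z] and taking roots of order [p.+1] reduces this to
    [1 + z ^+ 2 / 4 <= expR z]. *)
Lemma sqr_exprn_le_expR (c s : R) (p : nat) : 0 <= c -> 0 <= s ->
  exists2 K : R, 0 < K &
  forall y, 0 <= y -> (c * y ^+ 2 + s) ^+ p.+1 <= K * expR y.
Proof.
move=> c0 s0; set K := c * (4 * p.+1%:R ^+ 2) + s + 1.
have p2 : 0 <= p.+1%:R ^+ 2 :> R by rewrite exprn_ge0.
have K0 : 0 < K by rewrite /K ltr_wpDl// addr_ge0// mulr_ge0// mulr_ge0.
exists (K ^+ p.+1); first by rewrite exprn_gt0.
move=> y y0; pose z := y / p.+1%:R.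
have z0 : 0 <= z by rewrite divr_ge0.
have yE : y = p.+1%:R * z by rewrite /z mulrC divfK// pnatr_eq0.
have -> : expR y = expR z ^+ p.+1 by rewrite yE expRM_natl.
rewrite -exprMn; apply: lerXn2r; rewrite ?nnegrE.
- by rewrite addr_ge0// mulr_ge0// sqr_ge0.
- by rewrite mulr_ge0 ?expR_ge0// ltW.
have e2 : expR z = expR (z / 2) ^+ 2 by rewrite -expRM_natl; congr expR; lra.
have e1 : 1 + z ^+ 2 / 4 <= expR z.
  rewrite e2; apply: (@le_trans _ _ ((1 + z / 2) ^+ 2)); first by lra.
  rewrite lerXn2r ?nnegrE ?expR_ge0 ?expR_ge1Dx//; lra.
rewrite yE /K.
have z2 := sqr_ge0 z.
have h2 : 0 <= c * p.+1%:R ^+ 2 * (expR z * 4 - z ^+ 2).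
  by rewrite mulr_ge0 ?(mulr_ge0 c0 p2)//; lra.
have h1 : 0 <= s * (expR z - 1) by rewrite mulr_ge0//; lra.
have := expR_ge0 z; rewrite exprMn; lra.
Qed.

Lemma powR_eventually_ge (e K : R) : 0 < e ->
  exists n0 : nat, forall n, (n0 <= n)%N -> K <= n%:R `^ e.
Proof.
move=> e0; pose L := Num.max K 0.
have L0 : 0 <= L by rewrite le_max lexx orbT.
exists (Num.bound (L `^ e^-1)) => n hn.
apply: (@le_trans _ _ L); first by rewrite le_max lexx.
have LE : L = (L `^ e^-1) `^ e by rewrite -powRrM mulVf ?gt_eqF// powRr1.
rewrite LE; apply: ge0_ler_powR; rewrite ?nnegrE ?powR_ge0 ?ler0n ?(ltW e0)//.
apply/ltW; apply: lt_le_trans (archi_boundP _) _; first exact: powR_ge0.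
by rewrite ler_nat.
Qed.

(** The increments of [k ^+ 2] are [1 + 2 * k] and [1 - 2 * k], so the linear part of the expansion
    gains [b * (1 + 2 * k * (1 - 2 * q)) / Y], at least [b * (1 + 2 * w) / Y]; the quadratic part
    costs at most [w / 4 / Y]. *)
Lemma one_step_gain (C a k q s B : R) (b : nat) (Y := k ^+ 2 + s * a)
    (w := C * k ^+ 2 / (a + C * k)) :
  0 < C -> 1 <= a -> 1 <= k -> 0 <= q <= 1 -> 0 < B ->
  (forall x : R, `|x| <= 2^-1 ->
    ((1 + x) ^+ b)^-1 <= 1 - b%:R * x + B * x ^+ 2) ->
  s = 36 * B / C + (36 * B) ^+ 2 / 4 + 6 ->
  C * k / (a + C * k) <= 1 - 2 * q ->
  (1 - q) * ((1 + (1 + 2 * k) / Y) ^+ b)^-1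
    + q * ((1 + (1 - 2 * k) / Y) ^+ b)^-1
  <= 1 - (b%:R + (2 * b%:R - 4^-1) * w) / Y.
Proof.
move=> C0 a1 k1 /andP[q0 q1] B0 HB sE hq.
have b0 : 0 <= b%:R :> R by rewrite ler0n.
have D0 : 0 < a + C * k by rewrite ltr_wpDr ?mulr_ge0//; lra.
have BC : 0 < B / C by rewrite divr_gt0.
have s6 : 6 <= s by rewrite sE; have := sqr_ge0 (36 * B); lra.
have sa : 0 <= (s - 6) * (a - 1) by rewrite mulr_ge0//; lra.
have k2 : 0 <= (k - 2) ^+ 2 by exact: sqr_ge0.
(* Since [Y >= k ^+ 2 + 6], both relative increments lie between -1/2 and 1/2, where the expansion
   is valid. *)
have Y1 : 4 * k + 2 <= Y by rewrite /Y; lra.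
have Y0 : 0 < Y by lra.
have bd x : `|x| <= 2 * k + 1 -> `|x / Y| <= 2^-1.
  move=> hx; rewrite normrM normfV (gtr0_norm Y0) ler_pdivrMr//; lra.
have h1 := HB _ (bd (1 + 2 * k) _).
have h2 := HB _ (bd (1 - 2 * k) _).
have {}h1 := h1 ltac:(rewrite ger0_norm; lra).
have {}h2 := h2 ltac:(rewrite ler0_norm; lra).
have q1' : 0 <= 1 - q by lra.
apply: le_trans (lerD (ler_wpM2l q1' h1) (ler_wpM2l q0 h2)) _.
have w0 : 0 <= w by rewrite /w divr_ge0 ?mulr_ge0 ?sqr_ge0//; lra.
have wq : w <= k * (1 - 2 * q).
  have -> : w = k * (C * k / (a + C * k)) by rewrite /w; field; rewrite gt_eqF.
  by rewrite ler_wpM2l//; lra.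
(* the choice of [s] makes the second-order term absorb at most [w / 4] *)
have quad : 9 * B * k ^+ 2 / Y <= w / 4.
  rewrite ler_pdivrMr// /w.
  have -> : C * k ^+ 2 / (a + C * k) / 4 * Y = C * k ^+ 2 * Y / 4 / (a + C * k).
    by field; rewrite gt_eqF.
  rewrite ler_pdivlMr//.
  have -> : C * k ^+ 2 * Y / 4 = k ^+ 2 / 4 * (C * Y) by lra.
  have -> : 9 * B * k ^+ 2 * (a + C * k) = k ^+ 2 / 4 * (36 * B * (a + C * k)).
    by lra.
  rewrite ler_wpM2l ?divr_ge0 ?sqr_ge0//.
  have -> : C * Y = C * k ^+ 2 + 36 * B * a + C * (a * ((36 * B) ^+ 2 / 4 + 6)).
    by rewrite /Y sE; field; rewrite gt_eqF.
  (* The term [(36 * B) ^+ 2 / 4] of [s] completes the square that absorbs [36 * B * C * k]; the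
     term [36 * B / C] has matched [36 * B * a]. *)
  have t1 : 0 <= C * (k - 18 * B) ^+ 2 by rewrite mulr_ge0 ?sqr_ge0 ?ltW.
  have t2 : 0 <= C * ((a - 1) * ((36 * B) ^+ 2 / 4 + 6)).
    rewrite mulr_ge0 ?(ltW C0)// mulr_ge0; [lra| lra |].
    by have := sqr_ge0 (36 * B); lra.
  lra.
have sqb x : `|x| <= 2 * k + 1 -> B * (x / Y) ^+ 2 <= 9 * B * k ^+ 2 / Y / Y.
  move=> hx; have -> : 9 * B * k ^+ 2 / Y / Y = B * (3 * k / Y) ^+ 2.
    by field; rewrite gt_eqF.
  rewrite ler_pM2l// -[leLHS]real_normK ?num_real//.
  rewrite lerXn2r ?nnegrE//; first by rewrite divr_ge0; lra.
  by rewrite normrM normfV (gtr0_norm Y0) ler_pM2r ?invr_gt0//; lra.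
have e1 := sqb (1 + 2 * k) ltac:(rewrite ger0_norm; lra).
have e2 := sqb (1 - 2 * k) ltac:(rewrite ler0_norm; lra).
have e1' := ler_wpM2l q1' e1.
have e2' := ler_wpM2l q0 e2.
have quad' : 9 * B * k ^+ 2 / Y / Y <= w / 4 / Y by rewrite ler_pM2r ?invr_gt0.
have lin : 0 <= b%:R * (2 * (k * (1 - 2 * q) - w)) / Y.
  by rewrite divr_ge0 ?(ltW Y0)// mulr_ge0//; lra.
lra.
Qed.

(** For the second bound, the part [s * a] of [Y] is paid by [b * n] and the part [k ^+ 2] by the
    term in [w], where the margin 1/4 between the coefficients absorbs [a] against [C * n]. *)
Lemma gain_exceeds_growth (C a k s n : R) (b : nat) (Y := k ^+ 2 + s * a)
    (w := C * k ^+ 2 / (a + C * k)) (g := (b%:R + (2 * b%:R - 4^-1) * w) / Y) :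
  0 < C -> 1 <= a -> 1 <= k <= n -> (1 <= b)%N -> 0 <= s ->
  2 * s * a <= n -> 8 * b%:R / C * a <= n ->
  b%:R / Y <= g /\ (2 * b%:R - 2^-1) / n <= g.
Proof.
move=> C0 a1 /andP[k1 kn] b1 s0 hs hC.
have b1' : 1 <= b%:R :> R by rewrite ler1n.
have D0 : 0 < a + C * k by rewrite ltr_wpDr ?mulr_ge0//; lra.
have w0 : 0 <= w by rewrite /w divr_ge0 ?mulr_ge0 ?sqr_ge0//; lra.
have k2 : 0 < k ^+ 2 by rewrite exprn_gt0//; lra.
have Y0 : 0 < Y by rewrite /Y ltr_wpDr// mulr_ge0//; lra.
have n0 : 0 < n by lra.
have bw : 0 <= (2 * b%:R - 4^-1) * w by rewrite mulr_ge0//; lra.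
split; first by rewrite /g ler_pM2r ?invr_gt0//; lra.
rewrite /g ler_pdivlMr// mulrAC ler_pdivrMr//.
have e1 : 0 <= (b%:R - 4^-1) * (n - 2 * s * a) by rewrite mulr_ge0//; lra.
suff e2 : (2 * b%:R - 2^-1) * k ^+ 2 <= (2 * b%:R - 4^-1) * w * n by rewrite /Y; lra.
have -> : (2 * b%:R - 4^-1) * w * n
    = (2 * b%:R - 4^-1) * C * n * k ^+ 2 / (a + C * k).
  by rewrite /w; field; rewrite gt_eqF.
rewrite ler_pdivlMr// mulrAC ler_pM2r//.
have hC' : 8 * b%:R * a <= C * n.
  by move: hC; rewrite mulrAC ler_pdivrMr//; lra.
have e3 : 0 <= (2 * b%:R - 2^-1) * C * (n - k).
  by rewrite mulr_ge0 ?mulr_ge0//; lra.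
lra.
Qed.

(** The expansion of inverse powers is applied to [n = n.+1 * (1 - t)] with [t = 1 / n.+1]; the
    surplus 1/4 covers the quadratic term once [n >= 4 * B]. *)
Lemma exprS_growth (m : nat) : exists n0 : nat, forall n : nat, (n0 <= n)%N ->
  n.+1%:R ^+ m <= n%:R ^+ m * (1 + (m%:R + 4^-1) / n%:R) :> R.
Proof.
have [B B0 HB] := inv_expr_taylor_le m.
exists (Num.bound (4 * B)).+1 => n hn.
have n1 : (1 <= n)%N by apply: leq_trans hn.
have n1' : 1 <= n%:R :> R by rewrite ler1n.
have nB : 4 * B <= n%:R.
  have B4 : 0 <= 4 * B by lra.
  apply: (le_trans (ltW (archi_boundP B4))).
  by rewrite ler_nat; apply: leq_trans hn.
set t : R := n.+1%:R^-1.
have nS : n.+1%:R = n%:R + 1 :> R by rewrite natr1.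
have t0 : 0 < t by rewrite invr_gt0 nS; lra.
have tn : t * (n%:R + 1) = 1 by rewrite /t nS mulVf// gt_eqF//; lra.
have ht : `|- t| <= 2^-1.
  rewrite normrN gtr0_norm// /t lef_pV2 ?posrE ?ltr0n// nS; lra.
have e1 : n%:R = n.+1%:R * (1 + - t) by rewrite nS; lra.
have := HB _ ht.
have t1 : 0 < 1 + - t.
  by move: ht; rewrite normrN gtr0_norm//; lra.
have en : n.+1%:R ^+ m = n%:R ^+ m * ((1 + - t) ^+ m)^-1 :> R.
  by rewrite [in RHS]e1 exprMn mulfK// expf_neq0// gt_eqF.
rewrite en => h; rewrite ler_pM2l ?exprn_gt0//; last by lra.
apply: le_trans h _.
have tn' : t <= n%:R^-1 by rewrite /t lef_pV2 ?posrE ?ltr0n// nS; lra.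
have m0 : 0 <= m%:R :> R by rewrite ler0n.
have h1 : m%:R * t <= m%:R * n%:R^-1 by rewrite ler_wpM2l.
have h2 : B * t <= 4^-1.
  have : B * t <= B * n%:R^-1 by rewrite ler_pM2l.
  have : B / n%:R <= 4^-1 by rewrite ler_pdivrMr//; lra.
  lra.
have h3 : B * t * t <= 4^-1 * t by rewrite ler_wpM2r// ltW.
lra.
Qed.

(** * Bounds on the probability of a down step *)

Lemma down_prob_ge0 (alpha C : R) n k : 0 <= down_prob alpha C n k.
Proof. by rewrite mulr_ge0 ?expR_ge0// invr_ge0. Qed.

(** With [y = C * k / a] this is [1 + y <= expR y]. *)
Lemma down_prob_drift (alpha C : R) (n k : nat) (a := n%:R `^ alpha) :
  0 <= C -> 0 < a ->
  C * k%:R / (a + C * k%:R) <= 1 - 2 * down_prob alpha C n k.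
Proof.
move=> C0 a0; rewrite /down_prob -/a; set y := C * k%:R / a.
have y0 : 0 <= y by rewrite divr_ge0 ?mulr_ge0// ltW.
have Ck : 0 <= C * k%:R by rewrite mulr_ge0.
have -> : C * k%:R / (a + C * k%:R) = 1 - (1 + y)^-1.
  by rewrite /y; field; rewrite !gt_eqF//; lra.
have : expR (- y) <= (1 + y)^-1.
  by rewrite expRN lef_pV2 ?posrE ?expR_gt0 ?expR_ge1Dx//; lra.
lra.
Qed.

Lemma down_prob_le_half (alpha C : R) n k : 0 <= C ->
  down_prob alpha C n k <= 2^-1.
Proof.
move=> C0; rewrite /down_prob ler_piMr ?invr_ge0//.
by rewrite -[leRHS]expR0 ler_expR oppr_le0 divr_ge0 ?powR_ge0 ?mulr_ge0.
Qed.

(** * The Lyapunov function and its one-step decrease *)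

Definition lyap (alpha s : R) (b n k : nat) : R :=
  n%:R ^+ (2 * b).-1 / (k%:R ^+ 2 + s * n%:R `^ alpha) ^+ b.

Lemma lyap_ge0 alpha s b n k : 0 <= s -> 0 <= lyap alpha s b n k.
Proof.
by move=> s0; rewrite divr_ge0 ?exprn_ge0// addr_ge0 ?sqr_ge0 ?mulr_ge0 ?powR_ge0.
Qed.

(** The 1 gained in the denominator outweighs the growth of the prefactor, as [s * a * ((n + 1) / n)
    ^+ 2 <= s * a + 3 * s * a / n <= s * a + 1]. The step up from 0 being certain, no strict drop is
    asked for. *)
Lemma lyap_reflect (alpha s : R) (b n : nat) :
  0 < alpha -> 0 < s -> (0 < n)%N -> (0 < b)%N -> 3 * s * n%:R `^ alpha <= n%:R ->
  lyap alpha s b n.+1 1 <= lyap alpha s b n 0.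
Proof.
move=> al0 s0 n0 b0 hn; rewrite /lyap.
have nn : 0 < n%:R :> R by rewrite ltr0n.
have n1 : 1 <= n%:R :> R by rewrite ler1n.
set a := n%:R `^ alpha in hn *; have a0 : 0 < a by rewrite powR_gt0.
have aS : a <= n.+1%:R `^ alpha.
  by rewrite ge0_ler_powR ?nnegrE ?ltW// ltr_nat.
have sa : 0 < s * a by rewrite mulr_gt0.
rewrite expr0n/= add0r expr1n.
have L : (1 + s * n.+1%:R `^ alpha) >= s * a * (n.+1%:R / n%:R) ^+ 2.
  have -> : n.+1%:R / n%:R = 1 + n%:R^-1 :> R.
    by rewrite -natr1 mulrDl mulfV ?gt_eqF// mul1r.
  have i0 : 0 < n%:R^-1 :> R by rewrite invr_gt0.
  have i1 : n%:R^-1 <= 1 :> R by rewrite invf_le1.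
  have i2 : 3 * (s * a) * n%:R^-1 <= 1 by rewrite ler_pdivrMr//; lra.
  have i3 : (s * a) * n%:R^-1 * n%:R^-1 <= s * a * n%:R^-1.
    by rewrite ler_piMr// mulr_ge0// ltW.
  have sS : s * a <= s * n.+1%:R `^ alpha by rewrite ler_pM2l.
  lra.
have q0 : 0 < s * a * (n.+1%:R / n%:R) ^+ 2.
  by rewrite mulr_gt0// exprn_gt0// divr_gt0// ltr0n.
apply: (@le_trans _ _ (n.+1%:R ^+ (2 * b).-1 / (s * a * (n.+1%:R / n%:R) ^+ 2) ^+ b)).
  rewrite ler_wpM2l ?exprn_ge0// lef_pV2 ?posrE ?exprn_gt0//; last first.
    by apply: lt_le_trans L.
  by rewrite lerXn2r ?nnegrE ?(ltW q0)// (le_trans _ L)// ltW.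
have [m mE] : exists m, (2 * b = m.+1)%N by exists (2 * b).-1; rewrite prednK ?muln_gt0.
rewrite exprMn -exprM mE /= expr_div_n invfM invf_div !exprS.
rewrite [leLHS](_ : _ = n%:R ^+ m / (s * a) ^+ b * (n%:R / n.+1%:R)).
  rewrite ler_piMr ?divr_ge0 ?exprn_ge0 ?(ltW sa)// ler_pdivrMr ?ltr0n//.
  by rewrite mul1r ler_nat.
by field; rewrite !expf_neq0 ?gt_eqF ?ltr0n.
Qed.

(** The growth rate is at most [g] times [1 - 1 / (8 * b)], and the remaining share [g / (8 * b)] is
    at least [1 / (8 * Y)]. *)
Lemma gain_minus_growth (b Y g n : R) : 1 <= b -> 0 < Y -> 0 < n ->
  b / Y <= g -> (2 * b - 2^-1) / n <= g ->
  (8 * Y)^-1 <= g - (2 * b - 1 + 4^-1) / n.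
Proof.
move=> b1 Y0 n0 g1 g2.
have b8 : 0 < (8 * b)^-1 by rewrite invr_gt0; lra.
have c0 : 0 <= 1 - (8 * b)^-1 by rewrite subr_ge0 invf_le1//; lra.
have ug : (2 * b - 1 + 4^-1) / n <= g * (1 - (8 * b)^-1).
  apply: le_trans (ler_wpM2r c0 g2).
  rewrite mulrAC ler_pM2r ?invr_gt0//.
  have -> : (2 * b - 2^-1) * (1 - (8 * b)^-1) = 2 * b - 3 / 4 + (8 * b)^-1 / 2.
    by field; rewrite gt_eqF//; lra.
  lra.
have : (8 * Y)^-1 <= g * (8 * b)^-1.
  have -> : (8 * Y)^-1 = b / Y * (8 * b)^-1.
    by field; rewrite !gt_eqF//; lra.
  by rewrite ler_wpM2r// ltW.
lra.
Qed.

(** In the variable [y = C * k / a] one has [Y <= a ^+ 2 * (y ^+ 2 / C ^+ 2 + s)], so [expR y]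
    dominates [Y ^+ b.+1] up to a power of [a], which [n ^+ m] dominates in turn. *)
Lemma down_prob_le_lyap (alpha C s K : R) (b m n k : nat) (a := n%:R `^ alpha)
    (Y := k%:R ^+ 2 + s * a) :
  0 < C -> 1 <= a -> 0 < s -> 0 < n%:R :> R ->
  (forall y, 0 <= y -> (C ^- 2 * y ^+ 2 + s) ^+ b.+1 <= K * expR y) ->
  4 * K * a ^+ (2 * b.+1) <= n%:R ^+ m ->
  down_prob alpha C n k <= n%:R ^+ m / Y ^+ b / (8 * Y).
Proof.
move=> C0 a1 s0 n0 HK hK.
have a0 : 0 < a by exact: lt_le_trans a1.
have Y0 : 0 < Y by rewrite ltr_wpDl ?sqr_ge0// mulr_gt0.
rewrite /down_prob -/a; set y := C * k%:R / a.
have y0 : 0 <= y by rewrite divr_ge0 ?mulr_ge0//; lra.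
have YE : Y <= a ^+ 2 * (C ^- 2 * y ^+ 2 + s).
  have -> : a ^+ 2 * (C ^- 2 * y ^+ 2 + s) = k%:R ^+ 2 + s * a * a.
    by rewrite /y; field; rewrite !gt_eqF//; lra.
  have : 0 <= s * a * (a - 1) by rewrite !mulr_ge0//; lra.
  by rewrite /Y; lra.
have YK : Y ^+ b.+1 <= a ^+ (2 * b.+1) * (K * expR y).
  apply: (@le_trans _ _ ((a ^+ 2 * (C ^- 2 * y ^+ 2 + s)) ^+ b.+1)).
    by rewrite lerXn2r ?nnegrE ?(ltW Y0)// (le_trans (ltW Y0)).
  by rewrite exprMn -exprM ler_wpM2l ?HK// exprn_ge0//; lra.
have -> : n%:R ^+ m / Y ^+ b / (8 * Y) = n%:R ^+ m / (8 * Y ^+ b.+1).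
  by rewrite exprS; field; rewrite !gt_eqF// exprn_gt0.
rewrite ler_pdivlMr ?mulr_gt0 ?exprn_gt0//.
rewrite expRN [leLHS](_ : _ = 4 * Y ^+ b.+1 / expR y); last first.
  by field; rewrite gt_eqF ?expR_gt0.
rewrite ler_pdivrMr ?expR_gt0//.
have := ler_wpM2r (expR_ge0 y) hK.
lra.
Qed.

(** The mean of the next value is at most [(1 + u) * (1 - g) * W], with [u] the growth of the
    prefactor and [g] the gain at frozen time; the drop [W * (g - u)] is at least [W / (8 * Y)],
    hence at least [q]. *)
Lemma lyap_step (alpha C B s K : R) (b n k : nat) (m := (2 * b).-1)
    (a := n%:R `^ alpha) (q := down_prob alpha C n k) :
  0 < alpha -> 0 < C -> (0 < b)%N -> (1 <= k <= n)%N -> 0 < B ->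
  (forall x : R, `|x| <= 2^-1 ->
    ((1 + x) ^+ b)^-1 <= 1 - b%:R * x + B * x ^+ 2) ->
  s = 36 * B / C + (36 * B) ^+ 2 / 4 + 6 ->
  (forall y, 0 <= y -> (C ^- 2 * y ^+ 2 + s) ^+ b.+1 <= K * expR y) ->
  2 * s * a <= n%:R -> 8 * b%:R / C * a <= n%:R ->
  n.+1%:R ^+ m <= n%:R ^+ m * (1 + (m%:R + 4^-1) / n%:R) :> R ->
  4 * K * a ^+ (2 * b.+1) <= n%:R ^+ m ->
  (1 - q) * lyap alpha s b n.+1 k.+1 + q * lyap alpha s b n.+1 k.-1 + q
    <= lyap alpha s b n k.
Proof.
move=> al0 C0 b0 /andP[k1 kn] B0 HB sE HK hs hC hm hK.
have k1' : 1 <= k%:R :> R by rewrite ler1n.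
have b1 : 1 <= b%:R :> R by rewrite ler1n.
have kn' : k%:R <= n%:R :> R by rewrite ler_nat.
have n1 : 1 <= n%:R :> R by lra.
have n0 : 0 < n%:R :> R by lra.
have a1 : 1 <= a by rewrite -[leLHS](powRr0 n%:R) ler_powR// ltW.
have aS : a <= n.+1%:R `^ alpha.
  by rewrite ge0_ler_powR ?nnegrE ?(ltW al0)// ler_nat.
have q0 : 0 <= q by exact: down_prob_ge0.
have q12 : q <= 2^-1 by apply: down_prob_le_half; exact: ltW.
have q1 : 0 <= q <= 1 by apply/andP; split; lra.
have drift := @down_prob_drift alpha C n k (ltW C0) (lt_le_trans ltr01 a1).
have BC : 0 < B / C by rewrite divr_gt0.
have s6 : 6 <= s by rewrite sE; have := sqr_ge0 (36 * B); lra.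
have gain := one_step_gain C0 a1 k1' q1 B0 HB sE drift.
have kn2 : (1 <= k%:R :> R) && (k%:R <= n%:R :> R) by apply/andP.
have [g1 g2] := gain_exceeds_growth C0 a1 kn2 b0 (le_trans (ler0n _ _) s6) hs hC.
move: gain g1 g2 => {HB sE hs hC BC kn2 drift}.
set Y := k%:R ^+ 2 + s * a; set g := (_ + _ * (_ / _)) / Y => gain g1 g2.
have sa : 0 <= (s - 6) * (a - 1) by rewrite mulr_ge0//; lra.
have k2 : 0 <= (k%:R - 2) ^+ 2 :> R by exact: sqr_ge0.
have Yk : 4 * k%:R + 2 <= Y by rewrite /Y; lra.
have Y0 : 0 < Y by lra.
have mE : m%:R = 2 * b%:R - 1 :> R.
  by rewrite /m -subn1 natrB ?muln_gt0// natrM.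
set u := (m%:R + 4^-1) / n%:R in hm.
pose W := n%:R ^+ m / Y ^+ b.
have W0 : 0 < W by rewrite divr_gt0 ?exprn_gt0.
have -> : lyap alpha s b n k = W by [].
have u0 : 0 <= u by rewrite divr_ge0//; lra.
(* Time is frozen by using [n] instead of [n.+1] in the denominator, which only lowers it; [- Y < x]
   keeps it positive. *)
have bnd (j : nat) (x : R) : j%:R ^+ 2 = k%:R ^+ 2 + x -> - Y < x ->
    lyap alpha s b n.+1 j <= (1 + u) * W * ((1 + x / Y) ^+ b)^-1.
  move=> jE xY.
  have -> : (1 + u) * W * ((1 + x / Y) ^+ b)^-1
     = n%:R ^+ m * (1 + u) / (Y + x) ^+ b.
    rewrite /W (_ : Y + x = Y * (1 + x / Y)).
      rewrite exprMn; field; rewrite ?expf_neq0 ?gt_eqF//.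
      by rewrite -(ltr_pM2r Y0) mul0r mulrDl divfK ?gt_eqF//; lra.
    by field; rewrite gt_eqF.
  have Yx : Y + x <= j%:R ^+ 2 + s * n.+1%:R `^ alpha.
    by rewrite jE /Y; have := ler_wpM2l (le_trans (ler0n _ 6) s6) aS; lra.
  have Yx0 : 0 < Y + x by lra.
  have Yx1 := lt_le_trans Yx0 Yx.
  apply: ler_pM; rewrite ?exprn_ge0 ?invr_ge0 ?exprn_ge0 ?(ltW Yx1)//.
  by rewrite lef_pV2 ?posrE ?exprn_gt0// lerXn2r ?nnegrE ?(ltW Yx0) ?(ltW Yx1).
have up := bnd k.+1 (1 + 2 * k%:R) ltac:(rewrite -natr1; lra) ltac:(lra).
have dn := bnd k.-1 (1 - 2 * k%:R)
  ltac:(rewrite -subn1 natrB//; lra) ltac:(lra).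
have q1' : 0 <= 1 - q by lra.
have {}up := ler_wpM2l q1' up.
have {}dn := ler_wpM2l q0 dn.
have uW : 0 <= (1 + u) * W by rewrite mulr_ge0 ?(ltW W0)//; lra.
have {}gain := ler_wpM2l uW gain.
have g0 : 0 <= g by apply: le_trans g1; rewrite divr_ge0// ltW.
have gu : (8 * Y)^-1 <= g - u.
  rewrite /u mE; apply: gain_minus_growth => //; lra.
have fin : q <= W / (8 * Y).
  by apply: (down_prob_le_lyap (K := K)) => //; lra.
have : W * (8 * Y)^-1 <= W * (g - u) by rewrite ler_pM2l.
(* The cross term of [(1 + u) * (1 - g)] has a favourable sign. *)
have : 0 <= u * g * W by exact: mulr_ge0 (mulr_ge0 u0 g0) (ltW W0).
lra.
Qed.

Lemma lyapunov_exists (alpha C : R) : 0 < alpha -> alpha < 1 -> 0 < C ->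
  exists (V : nat -> nat -> R) (n0 : nat),
  [/\ forall n k, 0 <= V n k,
      forall n, (n0 <= n)%N -> V n.+1 1%N <= V n 0%N &
      forall n k, (n0 <= n)%N -> (1 <= k <= n)%N ->
        (1 - down_prob alpha C n k) * V n.+1 k.+1
          + down_prob alpha C n k * V n.+1 k.-1 + down_prob alpha C n k
        <= V n k].
Proof.
move=> al0 al1 C0.
have al1' : 0 < 1 - alpha by lra.
have ba0 : 0 <= 3 / (2 * (1 - alpha)) by rewrite divr_ge0//; lra.
pose b := (Num.bound (3 / (2 * (1 - alpha)))).+1.
have hb : 3 < 2 * b%:R * (1 - alpha).
  have : 3 / (2 * (1 - alpha)) < b%:R.
    by apply: lt_le_trans (archi_boundP ba0) _; rewrite ler_nat.
  by rewrite ltr_pdivrMr; lra.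
have [B B0 HB] := inv_expr_taylor_le b.
have [s sE] : exists s, s = 36 * B / C + (36 * B) ^+ 2 / 4 + 6 by eexists.
have BC : 0 < B / C by rewrite divr_gt0.
have s6 : 6 <= s by rewrite sE; have := sqr_ge0 (36 * B); lra.
have c0 : 0 <= C ^- 2 by rewrite invr_ge0 sqr_ge0.
have [K K0 HK] := sqr_exprn_le_expR b c0 (le_trans (ler0n _ 6) s6).
pose m := (2 * b).-1.
have mE : m%:R = 2 * b%:R - 1 :> R by rewrite /m -subn1 natrB ?muln_gt0// natrM.
have bS : b.+1%:R = b%:R + 1 :> R by rewrite natr1.
(* By [hb], [2 * b * (1 - alpha)] exceeds 3, hence [1 + 2 * alpha]; so [n ^+ m] eventually dominates
   any multiple of [a ^+ (2 * b.+1)]. *)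
have e0 : 0 < m%:R - alpha * (2 * b.+1%:R) by rewrite mE bS; lra.
(* One threshold serves every requirement that a multiple of [n ^ alpha] be at most [n]. *)
have [n1 h1] := powR_eventually_ge (3 * s + 8 * b%:R / C) al1'.
have [n2 h2] := powR_eventually_ge (4 * K) e0.
have [n3 h3] := exprS_growth m.
have bC : 0 <= b%:R / C by rewrite divr_ge0// ltW.
have lin n : (0 < n)%N -> (n1 <= n)%N ->
    (3 * s + 8 * b%:R / C) * n%:R `^ alpha <= n%:R.
  move=> n0 /h1 h; have nn : 0 < n%:R :> R by rewrite ltr0n.
  rewrite [leRHS](_ : _ = n%:R `^ (1 - alpha) * n%:R `^ alpha).
    by rewrite ler_wpM2r ?powR_ge0.
  by rewrite -powRD ?subrK ?powRr1 ?ler0n//; apply/implyP => _; rewrite gt_eqF.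
have a0 n : 0 <= n%:R `^ alpha :> R by exact: powR_ge0.
exists (lyap alpha s b), (maxn 1 (maxn n1 (maxn n2 n3))); split.
- by move=> n k; apply: lyap_ge0; lra.
- move=> n; rewrite !geq_max => /and4P[n0 l1 l2 l3].
  apply: lyap_reflect => //; first by lra.
  apply: le_trans (lin _ n0 l1).
  by have := mulr_ge0 bC (a0 n); lra.
- move=> n k; rewrite !geq_max => /and4P[n0 l1 l2 l3] hk.
  have sa : 0 <= s * n%:R `^ alpha by rewrite mulr_ge0//; lra.
  have nn : 0 < n%:R :> R by rewrite ltr0n.
  apply: (@lyap_step _ _ B s K) => //.
  + apply: le_trans (lin _ n0 l1); have := mulr_ge0 bC (a0 n); lra.
  + apply: le_trans (lin _ n0 l1); lra.
  + exact: h3.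
  + have := h2 _ l2; rewrite -/m.
    have -> : (n%:R `^ alpha) ^+ (2 * b.+1) = n%:R `^ (alpha * (2 * b.+1%:R)) :> R.
      by rewrite powRrM -natrM powR_mulrn// powR_ge0.
    have -> : n%:R ^+ m
        = n%:R `^ (m%:R - alpha * (2 * b.+1%:R)) * n%:R `^ (alpha * (2 * b.+1%:R)) :> R.
      rewrite -powRD ?subrK ?powR_mulrn//.
      by apply/implyP => _; rewrite gt_eqF.
    by move=> h; rewrite ler_wpM2r ?powR_ge0.
Qed.

End Lyapunov.

(** * Measurability and total probability for integer-valued variables *)

Section Probability.
Context (d : measure_display) (T : measurableType d) (R : realType).
Variable P : probability T R.

Lemma measurable_RVnat (X : {RV P >-> nat}) (B : set nat) :
  measurable [set w | B (X w)].
Proof. by rewrite -[X in measurable X]/(X @^-1` B); exact: measurable_funPTI. Qed.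

Lemma measurable_RVnat2 (X Y : {RV P >-> nat}) (r : nat -> nat -> bool) :
  measurable [set w | r (X w) (Y w)].
Proof.
rewrite (_ : [set w | r (X w) (Y w)] =
  \bigcup_k ([set w | r k (Y w)] `&` [set w | X w = k])).
  apply: bigcup_measurable => k _.
  apply: measurableI; first exact: (measurable_RVnat Y (fun y => r k y)).
  exact: (measurable_RVnat X [set k]).
apply/seteqP; split=> [w /= h|w [k _ [/= h1 h2]]]; first by exists (X w).
by rewrite /= h2.
Qed.

Lemma total_probability (X : {RV P >-> nat}) (A : set T) : measurable A ->
  P A = (\sum_(0 <= v <oo) P (A `&` [set w | X w = v]))%E.
Proof.
move=> mA; have {1}-> : A = \bigcup_v (A `&` [set w | X w = v]).
  by apply/seteqP; split=> [w Aw|w [v _ []]//]; exists (X w).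
rewrite measure_bigcup.
- by apply: eq_eseriesl => v; rewrite in_setT.
- by move=> v _; apply: measurableI => //; exact: (measurable_RVnat X [set v]).
- by move=> i j _ _ [w [[_ /= <-] [_ /= <-]]].
Qed.

Lemma total_probability_proportional (X : {RV P >-> nat}) (c : R) (A B : set T) :
  measurable A -> measurable B ->
  (forall v, P (A `&` [set w | X w = v]) = c%:E * P (B `&` [set w | X w = v]))%E ->
  (P A = c%:E * P B)%E.
Proof.
move=> mA mB h; rewrite (total_probability X mA) (total_probability X mB).
by rewrite -nneseriesZl//; apply: eq_eseriesr => v _; rewrite h.
Qed.

Lemma total_probability_ord (X : {RV P >-> nat}) (N : nat) (A : set T) :
  measurable A -> P [set w | (N < X w)%N] = 0%E ->
  fine (P A) = \sum_(k < N.+1) fine (P (A `&` [set w | X w = k])).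
Proof.
move=> mA h; have mk k : measurable (A `&` [set w | X w = k]).
  by apply: measurableI => //; exact: (measurable_RVnat X [set k]).
rewrite (total_probability X mA) (nneseries_split 0 N.+1)// add0n.
rewrite [X in (_ + X)%E]eseries0 ?adde0; last first.
  move=> k hk _; apply: (@subset_measure0 _ _ _ _ _ [set w | (N < X w)%N]) => //.
    exact: (measurable_RVnat X (fun x => N < x)%N).
  by move=> w [_ /= ->].
rewrite big_mkord sum_fine// => k _; exact: fin_num_measure.
Qed.

Lemma fine_probability_setIC (A B : set T) : measurable A -> measurable B ->
  fine (P A) = fine (P (B `&` A)) + fine (P (~` B `&` A)).
Proof.
move=> mA mB; rewrite -fineD; [|apply: fin_num_measure; apply: measurableI => //|
  apply: fin_num_measure; apply: measurableI => //; exact: measurableC].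
congr fine; rewrite -measureU.
- by rewrite -setIUl setUv setTI.
- exact: measurableI.
- by apply: measurableI => //; exact: measurableC.
- by rewrite setIACA setICr set0I.
Qed.

(** * One-step law of the chain and decrease of the mean of [V] *)

Section Chain.
Variables (alpha C : R) (D : nat -> {RV P >-> nat}).

Lemma measurable_prefix (x : nat -> nat) (i : nat) :
  measurable [set w | forall l, (l < i)%N -> D l w = x l].
Proof.
rewrite (_ : [set w | _] = \bigcap_(l in [set l | (l < i)%N]) [set w | D l w = x l]).
  by apply: bigcap_measurableType => // l _; exact: (measurable_RVnat (D l) [set x l]).
by apply/seteqP; split=> w /= h l; exact: h.
Qed.

(* Conditioning on the whole past is descended to conditioning on [D n] alone
   by summing over [D i] for [i = n - 1, ..., 0]. *)
Lemma cond_prob_history_sum (n k : nat) (A : set T) (c : R) :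
  measurable A ->
  (forall x : nat -> nat, (0 < P (history D x n))%E -> x n = k ->
     cond_prob P A (history D x n) = c) ->
  (P (A `&` [set w | D n w = k]) = c%:E * P [set w | D n w = k])%E.
Proof.
move=> mA hc; set E := [set w | D n w = k].
have mE : measurable E by exact: (measurable_RVnat (D n) [set k]).
pose pre (x : nat -> nat) i := [set w | forall l, (l < i)%N -> D l w = x l].
have mpre x i : measurable (pre x i) by exact: measurable_prefix.
(* Here [m] counts the past coordinates already summed out: only those before time [n - m] are still
   prescribed. *)
have main m x : (m <= n)%N ->
    (P (A `&` E `&` pre x (n - m)%N) = c%:E * P (E `&` pre x (n - m)%N))%E.
  elim: m x => [|m IH] x hm.
    rewrite subn0; pose y l := if l == n then k else x l.
    have hist : E `&` pre x n = history D y n.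
      apply/seteqP; split=> w.
        move=> [Ew hw] i; rewrite leq_eqVlt /y => /predU1P[->|ltin].
          by rewrite eqxx.
        by rewrite (ltn_eqF ltin); exact: hw.
      move=> hw; split; first by have := hw n (leqnn n); rewrite /y eqxx.
      by move=> l ltln; have := hw l (ltnW ltln); rewrite /y (ltn_eqF ltln).
    rewrite -setIA hist.
    have mH : measurable (history D y n) by rewrite -hist; exact: measurableI.
    (* A null history is out of reach of [hc], but then both sides vanish. *)
    have [P0|Pn0] := eqVneq (P (history D y n)) 0%E.
      rewrite P0 mule0; apply: subset_measure0 P0 => //; exact: measurableI.
    have Pp : (0 < P (history D y n))%E by rewrite lt_neqAle eq_sym Pn0 measure_ge0.
    have yn : y n = k by rewrite /y eqxx.
    have := hc y Pp yn; rewrite /cond_prob => h.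
    have f0 : fine (P (history D y n)) != 0 by rewrite gt_eqF// fine_gt0// Pp ltey_eq fin_num_measure.
    rewrite -[LHS]fineK ?fin_num_measure//; last exact: measurableI.
    rewrite -[in RHS](fineK (fin_num_measure P _ mH)) -EFinM; congr EFin.
    by rewrite -h divfK.
  apply: (@total_probability_proportional (D (n - m.+1)%N)).
  - by apply: measurableI => //; exact: measurableI.
  - exact: measurableI.
  move=> v; pose y l := if l == (n - m.+1)%N then v else x l.
  have stepE : pre x (n - m.+1)%N `&` [set w | D (n - m.+1)%N w = v] = pre y (n - m)%N.
    have -> : (n - m)%N = (n - m.+1).+1 by rewrite -subSS subSn.
    apply/seteqP; split=> w.
      move=> [hw /= Dv] l; rewrite ltnS leq_eqVlt /y => /predU1P[->|ltl].
        by rewrite eqxx.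
      by rewrite (ltn_eqF ltl); exact: hw.
    move=> hw; split; last by have := hw _ (ltnSn _); rewrite /y eqxx.
    by move=> l ltl; have := hw l (leqW ltl); rewrite /y (ltn_eqF ltl).
  by rewrite -!setIA stepE !setIA; apply: IH; exact: ltnW.
have := main n (fun=> 0%N) (leqnn n); rewrite subnn.
have -> : pre (fun=> 0%N) 0%N = setT by apply/seteqP; split.
by rewrite !setIT.
Qed.

Hypothesis hD : is_chain alpha C D.

Let p (A : set T) : R := fine (P A).
(** At [k = 0], where [down_prob] equals 1/2, the value 0 lets the same formulas cover
    reflection. *)
Let q (n k : nat) : R := if k == 0%N then 0 else down_prob alpha C n k.

Let mD n k : measurable [set w | D n w = k].
Proof. exact: (measurable_RVnat (D n) [set k]). Qed.

Let pE (A B : set T) (c : R) : measurable B ->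
  (P A = c%:E * P B)%E -> p A = c * p B.
Proof.
move=> mB; rewrite /p => ->.
by rewrite -[in LHS](fineK (fin_num_measure P _ mB)) -EFinM.
Qed.

Lemma step_up (n k : nat) : (1 <= n)%N ->
  p ([set w | D n.+1 w = k.+1] `&` [set w | D n w = k])
    = (1 - q n k) * p [set w | D n w = k].
Proof.
move=> n1; apply: pE => //; apply: cond_prob_history_sum => // x Px xk.
rewrite /q; have [k0|/eqP k0] := eqVneq k 0%N.
  by rewrite subr0 k0; apply: (chain_reflect hD) => //; rewrite xk.
by rewrite -xk; apply: (chain_up hD) => //; rewrite xk.
Qed.

Lemma step_down (n k : nat) : (1 <= n)%N ->
  p ([set w | D n.+1 w = k.-1] `&` [set w | D n w = k])
    = q n k * p [set w | D n w = k].
Proof.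
move=> n1; have [k0|/eqP k0] := eqVneq k 0%N; last first.
  apply: pE => //; apply: cond_prob_history_sum => // x Px xk.
  rewrite /q; move/eqP/negbTE: (k0) => ->.
  by rewrite -xk; apply: (chain_down hD) => //; rewrite xk.
(* The predecessor of 0 is 0, so the claim is that the chain does not stay there; the step to 1
   already takes the whole mass. *)
rewrite {1 2}k0 /q k0 /= mul0r.
have tot := fine_probability_setIC (mD n 0) (mD n.+1 1).
have := @step_up n 0 n1; rewrite /q eqxx subr0 mul1r /p => up.
have h0 : p (~` [set w | D n.+1 w = 1%N] `&` [set w | D n w = 0%N]) = 0.
  by rewrite /p; lra.
have m1 : measurable (~` [set w | D n.+1 w = 1%N] `&` [set w | D n w = 0%N]).
  by apply: measurableI => //; exact: measurableC.
have P0 : P (~` [set w | D n.+1 w = 1%N] `&` [set w | D n w = 0%N]) = 0%E.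
  by rewrite -[LHS]fineK ?fin_num_measure// -/(p _) h0.
rewrite /p (subset_measure0 _ m1 _ P0)//; first exact: measurableI.
by move=> w [/= -> ->].
Qed.


(** The steps to [k.+1] and [k.-1] are disjoint and exhaust the mass of [D n = k]. *)
Lemma step_other (n k j : nat) : (1 <= n)%N -> j != k.+1 -> j != k.-1 ->
  p ([set w | D n.+1 w = j] `&` [set w | D n w = k]) = 0.
Proof.
move=> n1 jk1 jk2; set E := [set w | D n w = k].
have mE : measurable E by exact: mD.
have pge0 (A : set T) : 0 <= p A by rewrite /p fine_ge0.
have mC (A : set T) : measurable A -> measurable (~` A) by exact: measurableC.
have mI (A B : set T) : measurable A -> measurable B -> measurable (A `&` B).
  exact: measurableI.
have e1 := fine_probability_setIC mE (mD n.+1 k.+1).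
have mE1 := mI _ _ (mC _ (mD n.+1 k.+1)) mE.
have e2 := fine_probability_setIC mE1 (mD n.+1 k.-1).
have e3 := fine_probability_setIC (mI _ _ (mC _ (mD n.+1 k.-1)) mE1) (mD n.+1 j).
have dn : [set w | D n.+1 w = k.-1] `&` (~` [set w | D n.+1 w = k.+1] `&` E)
    = [set w | D n.+1 w = k.-1] `&` E.
  apply/seteqP; split=> w [/= h1]; first by case.
  move=> h2; split=> //; split=> //=; rewrite h1.
  by apply/eqP; rewrite ltn_eqF// ltnS leq_pred.
have ot : [set w | D n.+1 w = j] `&`
      (~` [set w | D n.+1 w = k.-1] `&` (~` [set w | D n.+1 w = k.+1] `&` E))
    = [set w | D n.+1 w = j] `&` E.
  apply/seteqP; split=> w [/= h1]; first by case=> _ [].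
  by move=> h2; split=> //; split; [|split] => //=; rewrite h1; apply/eqP.
rewrite dn in e2; rewrite ot in e3.
have := @step_up n k n1; have := @step_down n k n1.
have := pge0 ([set w | D n.+1 w = j] `&` E).
have := pge0 (~` [set w | D n.+1 w = j] `&` (~` [set w | D n.+1 w = k.-1]
     `&` (~` [set w | D n.+1 w = k.+1] `&` E))).
rewrite /p -/E; lra.
Qed.

Lemma transition (n k j : nat) : (1 <= n)%N ->
  p ([set w | D n.+1 w = j] `&` [set w | D n w = k])
    = p [set w | D n w = k] *
      ((1 - q n k) * (j == k.+1)%:R + q n k * (j == k.-1)%:R).
Proof.
move=> n1; have kk : (k.+1 == k.-1) = false by rewrite gtn_eqF// ltnS leq_pred.
have [->|j1] := eqVneq j k.+1; first by rewrite ?eqxx kk step_up//= mulr1n mulr0n; ring.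
have [->|j2] := eqVneq j k.-1; first by rewrite ?eqxx step_down//= mulr1n mulr0n; ring.
by rewrite step_other//= mulr0n; ring.
Qed.

(** Induction from [D 1 = 1]. This turns series over states into finite sums, and confines the
    Lyapunov estimate to [k <= n]. *)
Lemma chain_le_time (n : nat) : (1 <= n)%N -> P [set w | (n < D n w)%N] = 0%E.
Proof.
case: n => // n _; elim: n => [|n IH].
  have m1 : measurable (~` [set w | D 1%N w = 1%N]) by exact: measurableC.
  have P0 : P (~` [set w | D 1%N w = 1%N]) = 0%E.
    by rewrite probability_setC// (chain_init1 hD) subee.
  apply: (subset_measure0 _ m1 _ P0).
    exact: (measurable_RVnat (D 1) (fun x => 1 < x)%N).
  by move=> w /= h1 h2; rewrite h2 in h1.
set A := [set w | _].
have mA : measurable A by exact: (measurable_RVnat (D n.+2) (fun x => n.+2 < x)%N).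
rewrite -[LHS]fineK ?fin_num_measure//; congr EFin.
rewrite (total_probability_ord mA IH) big1// => k _.
set E := [set w | D n.+1 w = k].
have mE : measurable E by exact: mD.
have mAE : measurable (A `&` E) by exact: measurableI.
suff -> : P (A `&` E) = 0%E by [].
rewrite (total_probability (D n.+2) mAE) eseries0// => j _ _.
have mjE : measurable ([set w | D n.+2 w = j] `&` E) by exact: measurableI.
have [hj|hj] := ltnP n.+2 j.
  apply: (subset_measure0 _ mjE) => //; first exact: measurableI.
    by move=> w [[_ h1] h2].
  rewrite -[LHS]fineK ?fin_num_measure//; congr EFin; apply: step_other => //.
    by rewrite gtn_eqF// (leq_trans _ hj)// !ltnS -ltnS.
  rewrite gtn_eqF// (leq_ltn_trans (leq_pred _))//.
  by rewrite (leq_trans (ltn_ord k))// ltnW// ltnW.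
rewrite (_ : _ `&` _ = set0) ?measure0//.
apply/seteqP; split=> // w [[/= h1 _] h2].
by move: h1; rewrite /A /= h2 ltnNge hj.
Qed.

Lemma not_up_prob (n : nat) : (1 <= n)%N ->
  p (~` [set w | D n.+1 w = (D n w + 1)%N])
    = \sum_(k < n.+1) q n k * p [set w | D n w = k].
Proof.
move=> n1; set U := [set w | _].
have mU : measurable U.
  rewrite (_ : U = [set w | D n.+1 w == (D n w + 1)%N]).
    exact: (measurable_RVnat2 _ _ (fun x y => x == (y + 1)%N)).
  by apply/seteqP; split=> w /eqP.
rewrite /p (total_probability_ord (measurableC mU) (chain_le_time n1)).
apply: eq_bigr => k _.
have := fine_probability_setIC (mD n k) mU.
have -> : U `&` [set w | D n w = k] = [set w | D n.+1 w = k.+1] `&` [set w | D n w = k].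
  by apply/seteqP; split=> w [/= + h]; rewrite /U /= h addn1.
have := @step_up n k n1; rewrite /p; lra.
Qed.

(** The supermartingale bound in integrated form: the one-step inequality is averaged over the law
    of [D n]. *)
Lemma lyapunov_sum_decrease (V : nat -> nat -> R) (n : nat) : (1 <= n)%N ->
  V n.+1 1%N <= V n 0%N ->
  (forall k, (1 <= k <= n)%N ->
     (1 - down_prob alpha C n k) * V n.+1 k.+1
       + down_prob alpha C n k * V n.+1 k.-1 + down_prob alpha C n k <= V n k) ->
  \sum_(k < n.+2) p [set w | D n.+1 w = k] * V n.+1 k
    + p (~` [set w | D n.+1 w = (D n w + 1)%N])
  <= \sum_(k < n.+1) p [set w | D n w = k] * V n k.
Proof.
move=> n1 hV0 hV.
(* Conditioning on [D n] and exchanging the sums leaves only the two targets [k.+1] and [k.-1]. *)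
have -> : \sum_(k < n.+2) p [set w | D n.+1 w = k] * V n.+1 k
   = \sum_(k < n.+1) p [set w | D n w = k] *
      ((1 - q n k) * V n.+1 k.+1 + q n k * V n.+1 k.-1).
  under eq_bigr => j _ do rewrite /p (total_probability_ord (mD n.+1 j)
    (chain_le_time n1)) mulr_suml.
  rewrite exchange_big/=; apply: eq_bigr => k _.
  under eq_bigr => j _ do rewrite -/(p _) transition//.
  under eq_bigr => j _ do rewrite -mulrA mulrDl -!mulrA.
  rewrite -mulr_sumr big_split/= -!mulr_sumr; congr (_ * (_ * _ + _ * _)).
    under eq_bigr => j _ do rewrite mulr_natl mulrb.
    by rewrite -big_mkcond/= big_ord1_eq !ltnS -ltnS ltn_ord.
  under eq_bigr => j _ do rewrite mulr_natl mulrb.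
  rewrite -big_mkcond/= big_ord1_eq ltnS.
  by rewrite (leq_trans (leq_pred _))// ltnW.
rewrite not_up_prob// -big_split/=; apply: ler_sum => k _.
rewrite [X in _ + X <= _]mulrC -mulrDr ler_wpM2l ?fine_ge0// /q.
have [->|k0] := eqVneq (k : nat) 0%N; first by lra.
by apply: hV; rewrite lt0n k0 -ltnS ltn_ord.
Qed.

End Chain.
End Probability.

(** * Telescoping and Borel-Cantelli for the non-upward steps *)

Theorem theorem1 (R : realType) (alpha C : R)
    (halpha0 : 0 < alpha) (halpha1 : alpha < 1) (hC : 0 < C)
    (d : measure_display) (T : measurableType d) (P : probability T R)
    (D : nat -> {RV P >-> nat}) (hD : is_chain alpha C D) :
  P [set w | exists N : nat, forall n : nat, (N <= n)%N ->
       D n.+1 w = (D n w + 1)%N] = 1%E.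
Proof.
have [V [n1 [V0 hV1 hV2]]] := lyapunov_exists halpha0 halpha1 hC.
(* The successor ensures [n0 >= 1]: the transition law is prescribed only from time 1 on. *)
pose n0 := n1.+1.
pose F i : set T := ~` [set w | D (n0 + i)%N.+1 w = (D (n0 + i)%N w + 1)%N].
have mF i : measurable (F i).
  apply: measurableC.
  rewrite (_ : [set w | _] = [set w | D (n0 + i)%N.+1 w == (D (n0 + i)%N w + 1)%N]).
    exact: (measurable_RVnat2 _ _ (fun x y => x == (y + 1)%N)).
  by apply/seteqP; split=> w /eqP.
pose S n := \sum_(k < n.+1) fine (P [set w | D n w = k]) * V n k.
have S0 n : 0 <= S n by apply: sumr_ge0 => k _; rewrite mulr_ge0// fine_ge0.
have dec i : S (n0 + i)%N.+1 + fine (P (F i)) <= S (n0 + i)%N.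
  apply: (lyapunov_sum_decrease hD) => //.
    by apply: hV1; rewrite /n0 addSn ltnW// ltnS leq_addr.
  by move=> k hk; apply: hV2 => //; rewrite /n0 addSn ltnW// ltnS leq_addr.
(* Telescoping of [dec]; as [S] is nonnegative, the partial sums stay below [S n0]. *)
have bound N : \sum_(0 <= i < N) fine (P (F i)) <= S n0 - S (n0 + N)%N.
  elim: N => [|N IH]; first by rewrite big_geq// addn0 subrr.
  by rewrite big_nat_recr//= addnS; have := dec N; lra.
have lim0 : P (lim_sup_set F) = 0%E.
  apply: lim_sup_set_cvg0 => //; apply: (@le_lt_trans _ _ (S n0)%:E); last exact: ltry.
  apply: lime_le; first exact: is_cvg_nneseries.
  apply: nearW => N.
  rewrite (eq_bigr (fun i => (fine (P (F i)))%:E)).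
    rewrite sumEFin lee_fin; apply: le_trans (bound N) _.
    by rewrite lerBlDr lerDl.
  by move=> i _; rewrite fineK// fin_num_measure.
(* Outside the limsup, all [F i] fail from some index [N] on, that is, every step from time [n0 + N]
   on is upward. *)
have -> : [set w | exists N : nat, forall n, (N <= n)%N -> D n.+1 w = (D n w + 1)%N]
    = ~` lim_sup_set F.
  apply/seteqP; split=> w /=.
    move=> [N hN] /(_ N I) [i /= Ni]; apply; apply: hN.
    by rewrite (leq_trans Ni)// leq_addl.
  move=> /existsNP[N /not_implyP[_ h]]; exists (n0 + N)%N => n hn.
  apply: contrapT => hne; apply: h; exists (n - n0)%N => /=.
    by rewrite leq_subRL// (leq_trans _ hn)// leq_addr.
  by rewrite /F /= subnKC// (leq_trans _ hn)// leq_addr.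
rewrite probability_setC ?lim0 ?sube0//.
by apply: bigcap_measurable => // n _; apply: bigcup_measurable => i _.
Qed.
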